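(* Let $A_1,A_2,A_3,A_4$ be four generic points on the real (resp. complex) projective plane. Draw the six lines $\ell_{ij}=(A_iA_j)$, $1\le i<j\le 4$. Pick points $Q\in\ell_{34}$, $P_{13}\in\ell_{13}$, $P_{23}\in\ell_{23}$ and $B_1,B_2\in\ell_{12}$ such that all the lines and intersection points constructed below are well defined. Construct $$P_{14}=(QP_{13})\cap\ell_{14},\quad P_{24}=(QP_{23})\cap\ell_{24},\quad B_3=(B_1P_{13})\cap(B_2P_{23}),\quad B_4=(B_1P_{14})\cap(B_2P_{24}).$$ Then the points $B_3,B_4,Q$ are collinear.
   Context: $(XY)$ denotes the line through two distinct points $X,Y$. A construction is well defined if each line is drawn through two distinct points and each intersection point is taken of two distinct lines. ''Generic'' choices are choices belonging to a suitable Zariski dense subset of the appropriate configuration space (concretely: the conclusion holds for all choices in some nonempty Zariski open subset). *)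

(* Defs.v *)
From HB Require Import structures.
From mathcomp Require Import all_boot all_order all_algebra.
From mathcomp Require Import mpoly.
From mathcomp Require Import reals.
From mathcomp Require Import complex.

Set Implicit Arguments.
Unset Strict Implicit.
Unset Printing Implicit Defensive.

Import GRing.Theory.

Local Open Scope ring_scope.

Section ProjectivePlane.
Variable K : fieldType.

(* Points of the projective plane over K: the lines through the origin of K^3.
   Its lines are the 2-dimensional subspaces, and incidence is inclusion. *)
Record ppoint := PPoint {
  pspace :> {vspace 'rV[K]_3};
  _ : \dim pspace == 1%N
}.

HB.instance Definition _ := [isSub for pspace].
HB.instance Definition _ := [Choice of ppoint by <:].

(* The line (XY); it has dimension 2 exactly when X != Y. *)
Definition line (X Y : ppoint) : {vspace 'rV[K]_3} := (X + Y)%VS.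

(* L != M is what makes the intersection of two lines well defined. *)
Definition meet_at (X : ppoint) (L M : {vspace 'rV[K]_3}) : Prop :=
  L != M /\ pspace X = (L :&: M)%VS.

Definition collinear (X Y Z : ppoint) : Prop :=
  exists L : {vspace 'rV[K]_3},
    [/\ \dim L = 2%N, (X <= L)%VS, (Y <= L)%VS & (Z <= L)%VS].

(* The variable of index [mxvec_index i j] is the j-th homogeneous coordinate
   of the i-th point; f is homogeneous of degree [d i] in those of point i. *)
Definition multihomogeneous (n : nat) (f : {mpoly K[n * 3]}) : Prop :=
  exists d : 'I_n -> nat, forall m, m \in msupp f ->
    forall i, (\sum_(j < 3) m (mxvec_index i j))%N = d i.

(* Open sets of the Zariski topology on the n-fold product of the projective
   plane: the complements of the zero loci of families F of multihomogeneous
   polynomials. The rows of M are homogeneous coordinates of the points. *)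
Definition zariski_open (n : nat) (U : ('I_n -> ppoint) -> Prop) : Prop :=
  exists F : {mpoly K[n * 3]} -> Prop,
    (forall f, F f -> multihomogeneous f) /\
    forall (A : 'I_n -> ppoint) (M : 'M[K]_(n, 3)),
      (forall i, pspace (A i) = <[row i M]>%VS) ->
      (U A <-> exists2 f, F f & f.@[fun k => mxvec M 0 k] != 0).

Definition generically (n : nat) (P : ('I_n -> ppoint) -> Prop) : Prop :=
  exists U : ('I_n -> ppoint) -> Prop,
    [/\ zariski_open U, exists A, U A & forall A, U A -> P A].

Record construction (A1 A2 A3 A4 Q P13 P23 B1 B2 P14 P24 B3 B4 : ppoint) :
    Prop := Construction {
  lines_A : uniq [:: A1; A2; A3; A4];
  on_Q : (Q <= line A3 A4)%VS;
  on_P13 : (P13 <= line A1 A3)%VS;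
  on_P23 : (P23 <= line A2 A3)%VS;
  on_B1 : (B1 <= line A1 A2)%VS;
  on_B2 : (B2 <= line A1 A2)%VS;
  line_QP13 : Q != P13;
  line_QP23 : Q != P23;
  line_B1P13 : B1 != P13;
  line_B2P23 : B2 != P23;
  line_B1P14 : B1 != P14;
  line_B2P24 : B2 != P24;
  def_P14 : meet_at P14 (line Q P13) (line A1 A4);
  def_P24 : meet_at P24 (line Q P23) (line A2 A4);
  def_B3 : meet_at B3 (line B1 P13) (line B2 P23);
  def_B4 : meet_at B4 (line B1 P14) (line B2 P24)
}.

End ProjectivePlane.

(* Main.v *)
Require Import Defs.
From HB Require Import structures.
From mathcomp Require Import all_boot all_order all_algebra.
From mathcomp Require Import mpoly.
From mathcomp Require Import reals.
From mathcomp Require Import complex.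
From mathcomp Require Import perm ring.

Set Implicit Arguments.
Unset Strict Implicit.
Unset Printing Implicit Defensive.

Import GRing.Theory.
Local Open Scope ring_scope.

(** Let Q = s A3 + t A4 in homogeneous coordinates, and expand every other point
    on the two points whose line carries it: P13 = x A1 + y A3,
    P23 = u A2 + v A3, and B1, B2 as combinations of A1 and A2. Subtracting a
    multiple of Q so as to trade A3 for A4 gives the next two points,

      P14 = s P13 - y Q = s x A1 - y t A4,  P24 = s P23 - v Q = s u A2 - v t A4.

    Write B3 = c B1 + d P13 = c' B2 + d' P23. When A1, A2, A3 are not collinear
    the A3-coordinate of this equality reads d y = d' v, and therefore

      s B3 - d y Q = s c B1 + d P14 = s c' B2 + d' P24.

    This vector lies on both lines that define B4. It is not zero when s != 0,
    since B1 != P14, so it represents B4, which is thus on the line (B3 Q).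
    If s = 0 then Q = A4, and P14, P24, B4 all coincide with Q. This is
    [construction_collinear], in which Q, P13, P23, B1, B2 may be in any special
    position that leaves the construction well defined.

    That A1, A2, A3 are not collinear is the non-vanishing of the 3 x 3
    determinant of their coordinates, a multihomogeneous polynomial, and it is
    satisfied by the coordinate points: this is [generically_noncollinear]. *)

(** * Homogeneous coordinates of points *)

Section Points.
Variable K : fieldType.
Implicit Types (X Y Z W : ppoint K) (u v w : 'rV[K]_3).

Lemma dim_ppoint X : \dim X = 1%N.
Proof. by case: X => V /= /eqP. Qed.

Lemma ppoint_eq_vline X w : w != 0 -> w \in pspace X -> pspace X = <[w]>%VS.
Proof.
move=> w0 wX; apply/esym/eqP; rewrite eqEdim -memvE wX.
by rewrite dim_ppoint dim_vline w0.
Qed.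

Lemma ppoint_repr X : exists2 v, v != 0 & pspace X = <[v]>%VS.
Proof.
have v0 : vpick X != 0 by rewrite vpick0 -dimv_eq0 dim_ppoint.
by exists (vpick X) => //; apply: ppoint_eq_vline => //; apply: memv_pick.
Qed.

Lemma vline_addP v w u :
  reflect (exists a b, u = a *: v + b *: w) (u \in (<[v]> + <[w]>)%VS).
Proof.
apply: (iffP memv_addP) => [[_ /vlineP[a ->] [_ /vlineP[b ->] ->]]|[a [b ->]]].
  by exists a, b.
by exists (a *: v); [|exists (b *: w)]; rewrite ?memvZ ?memv_line.
Qed.

Lemma ppoint_neq_indep X Y v w a b :
  pspace X = <[v]>%VS -> pspace Y = <[w]>%VS -> X != Y ->
  a *: v + b *: w = 0 -> a = 0 /\ b = 0.
Proof.
move=> eX eY neXY e.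
have v0 : v != 0 by rewrite -memv0 memvE -eX subv0 -dimv_eq0 dim_ppoint.
have w0 : w != 0 by rewrite -memv0 memvE -eY subv0 -dimv_eq0 dim_ppoint.
have a0 : a = 0.
  apply: contraNeq neXY => a0; rewrite -val_eqE /= eX; apply/eqP/esym.
  apply: ppoint_eq_vline => //; rewrite eY; apply/vlineP; exists (- (a^-1 * b)).
  move/eqP: e; rewrite addr_eq0 => /eqP/(congr1 ( *:%R a^-1)).
  by rewrite scalerA mulVf // scale1r scalerN scalerA scaleNr.
by move: e => /eqP; rewrite a0 scale0r add0r scaler_eq0 (negPf w0) orbF => /eqP.
Qed.

Lemma meet_at_vline X L M w : meet_at X L M ->
  w != 0 -> w \in L -> w \in M -> pspace X = <[w]>%VS.
Proof.
by case=> _ eX w0 wL wM; apply: ppoint_eq_vline; rewrite // eX memv_cap wL.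
Qed.

(** The auxiliary point W provides a line through X and Y when X = Y;
    collinearity asks for a line even if the points coincide. *)
Lemma collinear_line X Y Z W :
  Y != W -> (Z <= line X Y)%VS -> collinear X Z Y.
Proof.
move=> neYW ZXY.
have dim_line (U V : ppoint K) : U != V -> \dim (line U V) = 2%N.
  move=> neUV; rewrite /line dimv_disjoint_sum ?dim_ppoint //.
  have [u u0 eU] := ppoint_repr U; have [v v0 eV] := ppoint_repr V.
  apply/eqP; rewrite -subv0; apply/subvP => z; rewrite memv_cap eU eV.
  case/andP => /vlineP[a ->] /vlineP[b e].
  have [] := @ppoint_neq_indep U V u v a (- b) eU eV neUV.
    by rewrite e scaleNr subrr.
  by move=> -> _; rewrite scale0r mem0v.
have [eXY|neXY] := eqVneq X Y.
  exists (line Y W); split; rewrite ?dim_line //; first by rewrite eXY addvSl.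
    by move: ZXY; rewrite eXY /line addvv => /subv_trans-> //; rewrite addvSl.
  by rewrite addvSl.
by exists (line X Y); split; rewrite ?dim_line ?addvSl ?addvSr.
Qed.

End Points.

(** * The incidence theorem *)

Section Construction.
Variable K : fieldType.

(** In coordinates, B4 = s B3 - d y Q, unless Q = A4, where B4 = Q. Independence
    of A1, A2, A3 lets the two expressions of B3 be compared by coordinates. *)
Lemma construction_collinear
    (A1 A2 A3 A4 Q P13 P23 B1 B2 P14 P24 B3 B4 : ppoint K) :
  \dim (A1 + A2 + A3) = 3%N ->
  construction A1 A2 A3 A4 Q P13 P23 B1 B2 P14 P24 B3 B4 ->
  collinear B3 B4 Q.
Proof.
move=> dimA [_ onQ on13 on23 on1 on2 neQ13 neQ23 ne1_13 ne2_23 ne1_14 ne2_24].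
move=> def14 def24 def3 def4.
have [a1 _ eA1] := ppoint_repr A1; have [a2 _ eA2] := ppoint_repr A2.
have [a3 _ eA3] := ppoint_repr A3; have [a4 _ eA4] := ppoint_repr A4.
have [q q0 eQ] := ppoint_repr Q.
have [p13 _ e13] := ppoint_repr P13; have [p23 _ e23] := ppoint_repr P23.
have [b1 _ e1] := ppoint_repr B1; have [b2 _ e2] := ppoint_repr B2.
have [b3 b30 e3] := ppoint_repr B3.
have free_a x y z : x *: a1 + y *: a2 + z *: a3 = 0 ->
    [/\ x = 0, y = 0 & z = 0].
  move=> e; have : free [:: a1; a2; a3].
    by rewrite /free !span_cons span_nil addv0 addvA -eA1 -eA2 -eA3 dimA.
  move/freeP/(_ (fun i => nth 0 [:: x; y; z] i)) => fr.
  have {}fr i : nth 0 [:: x; y; z] (i : 'I_3) = 0.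
    by apply: fr; rewrite !big_ord_recl big_ord0 /= addr0 addrA.
  by split; [have := fr ord0 | have := fr (inord 1) | have := fr (inord 2)];
     rewrite ?inordK.
have mem X L v : pspace X = <[v]>%VS -> (X <= L)%VS -> v \in L.
  by move=> ->; rewrite memvE.
have /vline_addP[s [t eq]] : q \in (<[a3]> + <[a4]>)%VS.
  by rewrite -eA3 -eA4; apply: mem onQ.
have /vline_addP[x [y ep13]] : p13 \in (<[a1]> + <[a3]>)%VS.
  by rewrite -eA1 -eA3; apply: mem on13.
have /vline_addP[u [v ep23]] : p23 \in (<[a2]> + <[a3]>)%VS.
  by rewrite -eA2 -eA3; apply: mem on23.
have /vline_addP[k [l eb1]] : b1 \in (<[a1]> + <[a2]>)%VS.
  by rewrite -eA1 -eA2; apply: mem on1.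
have /vline_addP[m [n eb2]] : b2 \in (<[a1]> + <[a2]>)%VS.
  by rewrite -eA1 -eA2; apply: mem on2.
have : b3 \in pspace B3 by rewrite e3 memv_line.
case: (def3) => _ ->; rewrite memv_cap /line e1 e2 e13 e23.
case/andP => /vline_addP[c [d eb3]] /vline_addP[c' [d' eb3']].
apply: (collinear_line neQ13).
have [s0|s0] := eqVneq s 0.
  (* Q = A4 is on both lines through P14, on both through P24, hence on both
     through B4. *)
  have qA4 : q \in pspace A4.
    by rewrite eq s0 scale0r add0r memvZ // eA4 memv_line.
  have qQ : q \in pspace Q by rewrite eQ memv_line.
  have memr X Y : q \in pspace Y -> q \in line X Y.
    by move=> h; apply: subvP h; apply: addvSr.
  have meml X Y : q \in pspace X -> q \in line X Y.
    by move=> h; apply: subvP h; apply: addvSl.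
  have eP14 := meet_at_vline def14 q0 (meml _ _ qQ) (memr _ _ qA4).
  have eP24 := meet_at_vline def24 q0 (meml _ _ qQ) (memr _ _ qA4).
  have q4 X Y : pspace Y = <[q]>%VS -> q \in line X Y.
    by move=> eY; apply: memr; rewrite eY memv_line.
  by rewrite (meet_at_vline def4 q0 (q4 _ _ eP14) (q4 _ _ eP24)) -eQ addvSr.
have [_ _ ed3] : [/\ c * k + d * x - c' * m = 0,
    c * l - c' * n - d' * u = 0 & d * y - d' * v = 0].
  apply: free_a; rewrite -[RHS](subrr b3) {1}eb3 eb3' eb1 eb2 ep13 ep23.
  by apply/rowP => j; rewrite !mxE; ring.
have nz (X : ppoint K) (p : 'rV_3) (z : K) :
    pspace X = <[p]>%VS -> Q != X -> s *: p - z *: q != 0.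
  move=> eX neQX; apply: contraNneq s0 => e0.
  have [|_ ->] := @ppoint_neq_indep _ Q X q p (- z) s eQ eX neQX.
    by rewrite scaleNr addrC.
  exact: eqxx.
have eP14 : pspace P14 = <[s *: p13 - y *: q]>%VS.
  apply: meet_at_vline def14 _ _ _; first exact: nz e13 neQ13.
    by rewrite /line eQ e13; apply/vline_addP; exists (- y), s;
       rewrite scaleNr addrC.
  rewrite /line eA1 eA4; apply/vline_addP; exists (s * x), (- (y * t)).
  by rewrite ep13 eq; apply/rowP => j; rewrite !mxE; ring.
have eP24 : pspace P24 = <[s *: p23 - v *: q]>%VS.
  apply: meet_at_vline def24 _ _ _; first exact: nz e23 neQ23.
    by rewrite /line eQ e23; apply/vline_addP; exists (- v), s;
       rewrite scaleNr addrC.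
  rewrite /line eA2 eA4; apply/vline_addP; exists (s * u), (- (v * t)).
  by rewrite ep23 eq; apply/rowP => j; rewrite !mxE; ring.
have eB4 : pspace B4 = <[s *: b3 - (d * y) *: q]>%VS.
  apply: meet_at_vline def4 _ _ _.
  - apply: contraNneq b30 => e0.
    have [|] := ppoint_neq_indep (a := s * c) (b := d) e1 eP14 ne1_14.
      by rewrite -[RHS]e0 eb3; apply/rowP => j; rewrite !mxE; ring.
    move/eqP; rewrite mulf_eq0 (negPf s0) => /eqP c0 d0.
    by rewrite eb3 c0 d0 !scale0r addr0.
  - rewrite /line e1 eP14; apply/vline_addP; exists (s * c), d.
    by rewrite eb3; apply/rowP => j; rewrite !mxE; ring.
  rewrite /line e2 eP24; apply/vline_addP; exists (s * c'), d'.
  rewrite (subr0_eq ed3) eb3'; apply/rowP => j; rewrite !mxE; ring.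
rewrite eB4 -memvE /line e3 eQ; apply/vline_addP.
by exists s, (- (d * y)); rewrite scaleNr.
Qed.

End Construction.

(** * The genericity condition *)

Section Generic.
Variable K : fieldType.

Definition minor_mpoly n (f : 'I_3 -> 'I_n) : {mpoly K[n * 3]} :=
  \det (\matrix_(i < 3, j < 3) 'X_(mxvec_index (f i) j)).

Lemma meval_minor n (f : 'I_3 -> 'I_n) (M : 'M[K]_(n, 3)) :
  (minor_mpoly f).@[fun k => mxvec M 0 k] = \det (rowsub f M).
Proof.
rewrite /minor_mpoly -det_map_mx; congr (\det _); apply/matrixP => i j.
by rewrite !mxE /= mevalXU mxvecE.
Qed.

Lemma mxvec_index_eq n p (i k : 'I_n) (j l : 'I_p) :
  (mxvec_index i j == mxvec_index k l) = (i == k) && (j == l).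
Proof.
by rewrite (inj_eq (@cast_ord_inj _ _ _)) (inj_eq enum_rank_inj) xpair_eqE.
Qed.

(** Each term of the Leibniz expansion takes exactly one variable from each of
    the rows f 0, f 1, f 2, so its degree in the coordinates of point i is the
    number of k with f k = i, whatever the permutation. *)
Lemma multihomogeneous_minor n (f : 'I_3 -> 'I_n) :
  multihomogeneous (minor_mpoly f).
Proof.
exists (fun i => \sum_(k < 3) (f k == i))%N => m.
move=> /msupp_sum_le/flattenP[_ /mapP[s _ ->]] ms i.
have {ms} -> : m = (\sum_(k < 3) U_(mxvec_index (f k) (s k)))%MM.
  apply/esym/mem_msuppXP; move: ms.
  rewrite (big_morph _ (@mpolyXD _ _) (@mpolyX0 _ _)).
  under eq_bigr do rewrite mxE.
  case: odd_perm; rewrite ?expr1 ?expr0 ?mulN1r ?mul1r ?(perm_mem (msuppN _));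
    exact: id.
under eq_bigr do rewrite mnm_sumE.
rewrite exchange_big; apply: eq_bigr => k _ /=.
under eq_bigr do rewrite mnm1E mxvec_index_eq.
rewrite (bigD1 (s k)) //= eqxx andbT big1 ?addn0 // => j /negPf.
by rewrite eq_sym => ->; rewrite andbF.
Qed.

Lemma dim_span3_det (M : 'M[K]_3) :
  (\dim (<[row 0%R M]> + <[row 1%R M]> + <[row 2%R M]>) == 3%N) = (\det M != 0).
Proof.
have -> : (<[row 0%R M]> + <[row 1%R M]> + <[row 2%R M]>)%VS =
    <<[tuple row i M | i < 3]>>%VS.
  rewrite /= (_ : enum 'I_3 = [:: 0; 1; 2]); last first.
    by apply: (inj_map val_inj); rewrite val_enum_ord.
  by rewrite !span_cons span_nil addv0 addvA.
rewrite -[X in _ == X](size_tuple [tuple row i M | i < 3]).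
rewrite -/(free _); apply/idP/idP => [/freeP fr|det0].
  apply/det0P => -[v v0 e0]; case/negP: v0; apply/eqP/rowP => i; rewrite mxE.
  apply: (fr (v 0)); under eq_bigr do rewrite -tnth_nth tnth_mktuple.
  by rewrite -mulmx_sum_row.
apply/freeP => k; under eq_bigr do rewrite -tnth_nth tnth_mktuple.
move=> e0 i; apply: contraNeq det0 => ki; apply/det0P; exists (\row_i k i).
  by apply: contraNneq ki => /rowP/(_ i); rewrite !mxE => ->.
by rewrite mulmx_sum_row; under eq_bigr do rewrite mxE.
Qed.

(** Non-emptiness is witnessed by sending the selected indices to the three
    coordinate points, whose determinant is that of the identity matrix. *)
Lemma generically_noncollinear n (f : 'I_3 -> 'I_n)
    (P : ('I_n -> ppoint K) -> Prop) : injective f ->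
  (forall A : 'I_n -> ppoint K,
     \dim (A (f 0%R) + A (f 1%R) + A (f 2%R)) = 3%N -> P A) ->
  generically P.
Proof.
move=> f_inj holds_P.
exists (fun A : 'I_n -> ppoint K =>
  \dim (A (f 0%R) + A (f 1%R) + A (f 2%R)) = 3%N).
split=> //.
  exists (eq (minor_mpoly f)); split=> [_ <-|A M eA].
    exact: multihomogeneous_minor.
  rewrite !eA -3!(row_rowsub f); split=> [/eqP|[_ <-]].
    by rewrite dim_span3_det -meval_minor; exists (minor_mpoly f).
  by rewrite meval_minor -dim_span3_det => /eqP.
have dim_e (j : 'I_3) : \dim <[delta_mx 0 j : 'rV[K]_3]> == 1%N.
  rewrite dim_vline (_ : delta_mx _ _ != 0) //.
  by apply/eqP => /rowP/(_ j); rewrite !mxE !eqxx => /eqP; rewrite oner_eq0.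
(* An index outside the image of f gets the first coordinate point. *)
exists (fun i => PPoint (dim_e (odflt 0 [pick j | f j == i]))).
have pick_f j : odflt 0 [pick k | f k == f j] = j.
  by case: pickP => [k /eqP/f_inj|/(_ j)] //; rewrite eqxx.
rewrite /= !pick_f; apply/eqP.
by rewrite -!row1 dim_span3_det det1 oner_eq0.
Qed.

End Generic.

Lemma generically_construction_collinear (K : fieldType) :
  generically (fun A : 'I_4 -> ppoint K =>
    forall Q P13 P23 B1 B2 P14 P24 B3 B4 : ppoint K,
      construction (A 0) (A 1) (A 2) (A 3) Q P13 P23 B1 B2 P14 P24 B3 B4 ->
      collinear B3 B4 Q).
Proof.
pose w := widen_ord (leqnSn 3).
have w_inj : injective w by move=> i j /(congr1 val) /= /val_inj.
apply: (generically_noncollinear w_inj) => A.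
have [-> -> ->] : [/\ w 0 = 0, w 1 = 1 & w 2 = 2] by split; apply: val_inj.
by move=> dimA *; apply: construction_collinear dimA _; eassumption.
Qed.

Theorem theorem3p8 (R : realType) :
  generically (fun A : 'I_4 -> ppoint R =>
    forall Q P13 P23 B1 B2 P14 P24 B3 B4 : ppoint R,
      construction (A 0) (A 1) (A 2) (A 3) Q P13 P23 B1 B2 P14 P24 B3 B4 ->
      collinear B3 B4 Q) /\
  generically (fun A : 'I_4 -> ppoint (complex R) =>
    forall Q P13 P23 B1 B2 P14 P24 B3 B4 : ppoint (complex R),
      construction (A 0) (A 1) (A 2) (A 3) Q P13 P23 B1 B2 P14 P24 B3 B4 ->
      collinear B3 B4 Q).
Proof.
by split; apply: generically_construction_collinear.
Qed.
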